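(* Consider the unsupervised multitask Gaussian mixture problem ($\eta_t=0$ for all $t$) with $T\ge 1$ tasks, $N_1=\dots=N_T=D$ (sampling ratios $\alpha_t=1$ for all $t$), task correlations $C_{tt'}=c$ for all $t\ne t'$ with $0<c<1$, and equal signal-to-noise ratios $\lambda_t=\lambda>0$ for all $t$, with overlaps as defined in the context. Then the classification is impossible (that is, $q_{ut}=0$ for all $t$) whenever $$\lambda\le\frac1{\sqrt{1+(T-1)c^2}}.$$
   Context: Overlaps in the unsupervised case. Let $\mathbf C=(C_{tt'})$ with $C_{tt}=1$, let $\sigma_t=\lambda_t^{-1/2}$, $\mathbf M=\big(C_{tt'}/(\sigma_t\sigma_{t'})\big)_{t,t'=1}^T$ and $F(q)=\mathbb E[\tanh(\sqrt q\,Z+q)]$ for $q\ge0$, with $Z\sim\mathcal N(0,1)$. The overlaps $(q_{ut},q_{vt})_{t=1}^T$ (nonnegative numbers) are the stable solution of the fixed-point equations $$q_{ut}=\big[\mathbf M-\mathbf M(\mathbf I+\mathbf D\mathbf M)^{-1}\big]_{tt},\qquad q_{vt}=F(q_{ut}),\qquad 1\le t\le T,$$ where $\mathbf D=\operatorname{diag}(\alpha_tq_{vt})_{t=1}^T$. Here a solution is called stable if it is a (Lyapunov) stable fixed point, on $[0,\infty)^T$, of the iteration $\mathbf q_u\mapsto G(\mathbf q_u)$, $G_t(\mathbf q_u)=[\mathbf M-\mathbf M(\mathbf I+\mathbf D\mathbf M)^{-1}]_{tt}$ with $\mathbf D=\operatorname{diag}(\alpha_sF(q_{us}))_{s=1}^T$.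 The zero vector is always a solution; when there are several solutions the overlaps are, by convention, the stable one. Classification of task $t$ is called impossible if $q_{ut}=0$ and feasible if $q_{ut}>0$. *)

(* Defs.v *)
From mathcomp Require Import all_boot all_order all_algebra.
From mathcomp Require Import all_classical all_reals all_analysis.
Set Implicit Arguments.
Unset Strict Implicit.
Unset Printing Implicit Defensive.
Import Order.TTheory GRing.Theory Num.Theory.
Import numFieldNormedType.Exports.
Local Open Scope classical_set_scope.
Local Open Scope ring_scope.

Definition tanh (R : realType) (x : R) : R :=
  (expR x - expR (- x)) / (expR x + expR (- x)).

(* Expectation against the law N(0, 1) of Z (the second argument of
   normal_prob is the standard deviation). The integrand is bounded, so that
   fine loses no information. *)
Definition F (R : realType) (q : R) : R :=
  fine ('E_(normal_prob (0 : R) 1)[fun z : R => tanh (Num.sqrt q * z + q)])%E.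

Definition sigma (R : realType) (T : nat) (lambda : 'I_T -> R) (t : 'I_T) : R :=
  (Num.sqrt (lambda t))^-1.

Definition Mmx (R : realType) (T : nat) (lambda : 'I_T -> R) (C : 'M[R]_T) :
    'M[R]_T :=
  \matrix_(t, t') (C t t' / (sigma lambda t * sigma lambda t')).

(* qv |-> ([M - M (I + D M)^-1]_tt)_t with D = diag(alpha_t qv_t).
   When C is positive semidefinite and alpha, qv are nonnegative, I + D M is
   invertible, so that invmx is the genuine inverse. *)
Definition qu_of_qv (R : realType) (T : nat) (lambda alpha : 'I_T -> R)
    (C : 'M[R]_T) (qv : 'rV[R]_T) : 'rV[R]_T :=
  let M := Mmx lambda C in
  let D := diag_mx (\row_t (alpha t * qv 0 t)) in
  \row_t (M - M *m invmx (1%:M + D *m M)) t t.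

Definition qv_of_qu (R : realType) (T : nat) (qu : 'rV[R]_T) : 'rV[R]_T :=
  \row_t F (qu 0 t).

Definition G (R : realType) (T : nat) (lambda alpha : 'I_T -> R)
    (C : 'M[R]_T) (qu : 'rV[R]_T) : 'rV[R]_T :=
  qu_of_qv lambda alpha C (qv_of_qu qu).

Definition nonneg_orthant (R : realType) (T : nat) : set 'rV[R]_T :=
  [set q | forall t, 0 <= q 0 t].

(* Lyapunov stability of the point p for the iteration of g started in S. *)
Definition lyapunov_stable (R : realType) (V : normedModType R) (S : set V)
    (g : V -> V) (p : V) : Prop :=
  forall eps : R, 0 < eps ->
  exists2 delta : R, 0 < delta &
    forall x : V, S x -> `|x - p| < delta ->
    forall n : nat, `|iter n g x - p| < eps.

Definition overlap_solution (R : realType) (T : nat) (lambda alpha : 'I_T -> R)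
    (C : 'M[R]_T) (qu qv : 'rV[R]_T) : Prop :=
  [/\ nonneg_orthant qu, nonneg_orthant qv,
      forall t, qu 0 t = qu_of_qv lambda alpha C qv 0 t
    & forall t, qv 0 t = F (qu 0 t)].

Definition overlaps (R : realType) (T : nat) (lambda alpha : 'I_T -> R)
    (C : 'M[R]_T) (qu qv : 'rV[R]_T) : Prop :=
  overlap_solution lambda alpha C qu qv /\
  lyapunov_stable (@nonneg_orthant R T) (G lambda alpha C) qu.

Definition impossible (R : realType) (T : nat) (qu : 'rV[R]_T) (t : 'I_T) :
    Prop := qu 0 t = 0.

(* Main.v *)
Require Import Defs.
From mathcomp Require Import all_boot all_order all_algebra.
From mathcomp Require Import all_classical all_reals all_analysis.
From mathcomp Require Import measurable_realfun ring lra.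
Import Order.TTheory GRing.Theory Num.Theory.
Import numFieldNormedType.Exports.
Local Open Scope ring_scope.

(** Write e^-W sech W = 1 - tanh W for W = sqrt q Z + q. Since
    e^(-W^2/2) <= sech W <= 1, Gaussian integration of e^-W and e^(-W - W^2/2)
    gives 1 - e^(-q/2) <= F q <= 1 - e^(-q/2) / sqrt (1 + q), hence
    0 <= F q <= q, with F q < q for q > 0. As M - M (I + D M)^-1 <= M D M on
    the diagonal, G_t(q) <= sum_s M_ts^2 F(q_s), and under the hypothesis on
    lambda the rows satisfy sum_s M_ts^2 = lambda^2 (1 + (T - 1) c^2) <= 1.
    Therefore G does not increase the sup norm, which makes 0 stable, and a
    nonzero fixed point would have a coordinate of maximal size that strictly
    decreases under G. *)

Set Implicit Arguments.
Unset Strict Implicit.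

(** * Integration against the Gaussian density *)

(** The Gaussian density and the Radon-Nikodym derivative of [normal_prob m s] have the same
    integral over every measurable set, so they agree almost everywhere. *)
Lemma integral_normal_prob (R : realType) (m s : R) (f : R -> R) :
  (normal_prob m s).-integrable setT (EFin \o f) ->
  (\int[normal_prob m s]_x (f x)%:E =
   \int[lebesgue_measure]_x (f x * normal_pdf m s x)%:E)%E.
Proof.
move=> fi; have mf := measurable_int _ fi.
under [RHS]eq_integral do rewrite EFinM.
rewrite -(Radon_Nikodym_change_of_variables (normal_prob_dominates m s))//=.
apply: ae_eq_integral => //.
- apply: emeasurable_funM => //; apply: (measurable_int lebesgue_measure).
  apply: (integrableS _ _ (@subsetT _ _)) => //=.
  by apply: Radon_Nikodym_integrable; exact: normal_prob_dominates.
- apply: emeasurable_funM => //=.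
  by apply/measurable_EFinP; exact: measurable_normal_pdf.
- apply: ae_eqe_mul2l => /=.
  rewrite Radon_NikodymE//=; first exact: normal_prob_dominates.
  move=> dom; case: cid => /= h [h1 h2 h3].
  apply: integral_ae_eq => //=.
  + by apply/measurable_EFinP; exact: measurable_normal_pdf.
  + by move=> E E01 mE; rewrite -h3.
Qed.

(** * Pointwise bounds on hyperbolic functions *)

(** The difference of the two sides vanishes at 0 and has derivative x (e^x - e^-x) >= 0. It gives
    the sign of the derivative in [cosh_le_expR]. *)
Lemma sinh_le_mul_cosh (R : realType) (x : R) : 0 <= x ->
  expR x - expR (- x) <= x * (expR x + expR (- x)).
Proof.
move=> x0.
pose f (y : R) := y * (expR y + expR (- y)) - (expR y - expR (- y)).
have df (y : R) : is_derive y 1 f (y * (expR y - expR (- y))).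
  rewrite /f; apply: is_derive_eq.
  rewrite /GRing.scale/=; ring.
suff : f 0 <= f x by rewrite /f mul0r oppr0 !subrr subr_ge0.
apply: (@ger0_derive1_ndecry _ f 0) => //.
- move=> y; rewrite in_itv/= andbT => y0; rewrite derive1E derive_val.
  by rewrite mulr_ge0 ?(ltW y0)// subr_ge0 ler_expR; lra.
- by apply: derivable_within_continuous => y _.
Qed.

(** On x >= 0 the product e^(-x^2/2) (e^x + e^-x) is nonincreasing and starts at 2; evenness covers
    x < 0. Equivalently, sech x >= e^(-x^2/2). *)
Lemma cosh_le_expR (R : realType) (x : R) :
  expR x + expR (- x) <= 2 * expR (x ^+ 2 / 2).
Proof.
wlog x0 : x / 0 <= x.
  move=> H; have [|/ltW x0] := leP 0 x; first exact: H.
  by have := H (- x); rewrite opprK sqrrN addrC; apply; lra.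
pose f (y : R) := expR (- (y ^+ 2 / 2)) * (expR y + expR (- y)).
have df (y : R) : is_derive y 1 f (expR (- (y ^+ 2 / 2)) *
    ((expR y - expR (- y)) - y * (expR y + expR (- y)))).
  rewrite /f; apply: is_derive_eq.
  by rewrite /GRing.scale/=; field.
have : f x <= f 0.
  apply: (@ler0_derive1_nincry _ f 0) => //.
  - move=> y; rewrite in_itv/= andbT => y0; rewrite derive1E derive_val.
    by rewrite mulr_ge0_le0 ?expR_ge0// subr_le0 sinh_le_mul_cosh// ltW.
  - by apply: derivable_within_continuous => y _.
rewrite /f expr0n/= mul0r oppr0 expR0 mul1r expRN mulrC ler_pdivrMr ?expR_gt0//.
Qed.

Lemma norm_tanh_le1 (R : realType) (x : R) : `|tanh x| <= 1.
Proof.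
have px := expR_gt0 x; have pn := expR_gt0 (- x).
rewrite /tanh ler_norml ler_pdivlMr ?ler_pdivrMr ?addr_gt0//.
by apply/andP; split; lra.
Qed.

Lemma onem_tanhE (R : realType) (x : R) :
  1 - tanh x = expR (- x) * (2 / (expR x + expR (- x))).
Proof.
have px := expR_gt0 x; have pn := expR_gt0 (- x).
by rewrite /tanh; field; rewrite gt_eqF// addr_gt0.
Qed.

Lemma onem_tanh_le (R : realType) (x : R) : 1 - tanh x <= expR (- x).
Proof.
rewrite onem_tanhE ler_piMr ?expR_ge0//.
rewrite ler_pdivrMr ?mul1r ?addr_gt0 ?expR_gt0//.
have := expR_gt0 x; have : expR x * expR (- x) = 1.
  by rewrite -expRD subrr expR0.
set a := expR x; set b := expR (- x) => ab a0.
(* As ab = 1, (a - b)^2 >= 0 gives (a + b)^2 >= 4, hence a + b >= 2. *)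
have := sqr_ge0 (a - b); nra.
Qed.

Lemma onem_tanh_ge (R : realType) (x : R) :
  expR (- x) * expR (- (x ^+ 2 / 2)) <= 1 - tanh x.
Proof.
rewrite onem_tanhE ler_wpM2l ?expR_ge0//.
rewrite ler_pdivlMr ?addr_gt0 ?expR_gt0// expRN mulrC ler_pdivrMr ?expR_gt0//.
exact: cosh_le_expR.
Qed.

(** * Bounds on [F] by Gaussian integration *)

Lemma measurable_tanh (R : realType) : measurable_fun setT (@tanh R).
Proof.
apply: continuous_measurable_fun => x.
rewrite /tanh; apply: cvgM.
  apply: cvgB; first exact: continuous_expR.
  by apply: continuous_comp; [exact: opp_continuous|exact: continuous_expR].
apply: cvgV; first by rewrite gt_eqF// addr_gt0 ?expR_gt0.
apply: cvgD; first exact: continuous_expR.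
by apply: continuous_comp; [exact: opp_continuous|exact: continuous_expR].
Qed.

Lemma integrable_onem_tanh (R : realType) (q : R) :
  (normal_prob (0 : R) 1).-integrable setT
    (EFin \o (fun z : R => 1 - tanh (Num.sqrt q * z + q))).
Proof.
apply: measurable_bounded_integrable => //.
- by rewrite [X in (X < _)%E](@probability_setT _ _ _ (normal_prob 0 1)) ltry.
- apply: measurable_funB => //; apply: measurableT_comp.
    exact: measurable_tanh.
  by apply: measurable_funD => //; exact: measurable_funM.
- exists 2; split => // M M2 z _ /=.
  apply: le_trans (ltW M2); have := norm_tanh_le1 (Num.sqrt q * z + q).
  rewrite !ler_norml; lra.
Qed.

(** Passing to 1 - tanh makes the integrand nonnegative, so that pointwise bounds on it can be
    integrated directly. *)
Lemma onem_F_integral (R : realType) (q : R) :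
  ((1 - F q)%:E = \int[lebesgue_measure]_z
    ((1 - tanh (Num.sqrt q * z + q)) * normal_pdf (0 : R) 1 z)%:E)%E.
Proof.
have Pi := integrable_onem_tanh q.
rewrite -integral_normal_prob//.
rewrite /F unlock.
set g := fun z => tanh (Num.sqrt q * z + q).
have gE : (\int[normal_prob 0 1]_w (g w)%:E =
    \int[normal_prob (0 : R) 1]_w ((cst 1 w)%:E - (1 - g w)%:E))%E.
  by apply: eq_integral => w _; rewrite -EFinB /cst; congr EFin; ring.
rewrite gE integralB//=; last exact: finite_measure_integrable_cst.
have -> : (\int[normal_prob (0 : R) 1]_x (cst 1 x)%:E = 1)%E.
  apply: etrans (integral_cst _ _ 1%E) _ => //.
  by rewrite mul1e; exact: integral_normal_pdf.
have /fineK <- : (\int[normal_prob (0 : R) 1]_x (1 - g x)%:E)%E \is a fin_num.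
  exact: integrable_fin_num.
by rewrite -EFinB/=; congr EFin; ring.
Qed.

(* exp(-W) and exp(-W - W^2/2), W = s z + s^2, turn the standard normal density
   into multiples of other normal densities, whose total mass is known. *)
Lemma expRN_normal_pdf (R : realType) (s z : R) :
  expR (- (s * z + s ^+ 2)) * normal_pdf 0 1 z =
  expR (- (s ^+ 2 / 2)) * normal_pdf (- s) 1 z.
Proof.
rewrite !normal_pdfE ?oner_eq0// /normal_fun mulrCA [RHS]mulrCA -!expRD.
by congr (_ * expR _); field.
Qed.

Lemma expRN_sqr_normal_pdf (R : realType) (s z : R) :
  let w := s * z + s ^+ 2 in
  expR (- w) * expR (- (w ^+ 2 / 2)) * normal_pdf 0 1 z =
  expR (- (s ^+ 2 / 2)) / Num.sqrt (1 + s ^+ 2) *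
    normal_pdf (- s) (Num.sqrt (1 + s ^+ 2))^-1 z.
Proof.
have s1 : 0 < 1 + s ^+ 2 by rewrite ltr_pwDl ?sqr_ge0.
have r0 : Num.sqrt (1 + s ^+ 2) != 0 by rewrite sqrtr_eq0 -ltNge.
rewrite /= !normal_pdfE ?oner_eq0 ?invr_eq0// /normal_fun.
have -> : normal_peak (Num.sqrt (1 + s ^+ 2))^-1 =
    Num.sqrt (1 + s ^+ 2) * normal_peak (1 : R).
  rewrite /normal_peak exprVn sqr_sqrtr ?(ltW s1)// expr1n mul1r -mulrnAr.
  by rewrite sqrtrM ?invr_ge0 ?(ltW s1)// sqrtrV ?(ltW s1)// invfM invrK.
rewrite !mulrA divfK// [LHS]mulrAC [RHS]mulrAC -!expRD.
(* Completing the square: w + w^2/2 + z^2/2 = (1 + s^2) (z + s)^2/2 + s^2/2. *)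
congr (expR _ * _).
rewrite exprVn sqr_sqrtr ?(ltW s1)//.
by field; rewrite gt_eqF.
Qed.

Lemma F_ge (R : realType) (q : R) : 0 <= q -> 1 - expR (- (q / 2)) <= F q.
Proof.
move=> q0; rewrite lerBlDr -lerBlDl -lee_fin onem_F_integral.
have -> : ((expR (- (q / 2)))%:E = \int[lebesgue_measure]_z
    (expR (- (q / 2)) * normal_pdf (- Num.sqrt q) 1 z)%:E)%E.
  under eq_integral do rewrite EFinM.
  rewrite integralZl//; last exact: integrable_normal_pdf.
  by rewrite integral_normal_pdf mule1.
apply: ge0_le_integral => //=.
- move=> z _; rewrite lee_fin mulr_ge0 ?normal_pdf_ge0// subr_ge0.
  by have := norm_tanh_le1 (Num.sqrt q * z + q); rewrite ler_norml => /andP[].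
- apply/measurable_EFinP/measurable_funM; last exact: measurable_normal_pdf.
  by have /measurable_int/measurable_EFinP := integrable_onem_tanh q.
- apply/measurable_EFinP/measurable_funM => //; exact: measurable_normal_pdf.
- move=> z _; rewrite lee_fin -[q in q / 2]sqr_sqrtr// -expRN_normal_pdf.
  by rewrite sqr_sqrtr// ler_wpM2r ?normal_pdf_ge0// onem_tanh_le.
Qed.

Lemma F_ge0 (R : realType) (q : R) : 0 <= q -> 0 <= F q.
Proof.
move=> q0; apply: le_trans (F_ge q0).
by rewrite subr_ge0 -[leRHS]expR0 ler_expR; lra.
Qed.

Lemma F_le (R : realType) (q : R) : 0 <= q ->
  F q <= 1 - expR (- (q / 2)) / Num.sqrt (1 + q).
Proof.
move=> q0; rewrite lerBrDl -lerBrDr -lee_fin onem_F_integral.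
have -> : ((expR (- (q / 2)) / Num.sqrt (1 + q))%:E = \int[lebesgue_measure]_z
    (expR (- (q / 2)) / Num.sqrt (1 + q) *
     normal_pdf (- Num.sqrt q) (Num.sqrt (1 + q))^-1 z)%:E)%E.
  under eq_integral do rewrite EFinM.
  rewrite integralZl//; last exact: integrable_normal_pdf.
  by rewrite integral_normal_pdf mule1.
apply: ge0_le_integral => //=.
- by move=> z _; rewrite lee_fin mulr_ge0 ?normal_pdf_ge0// divr_ge0 ?expR_ge0.
- apply/measurable_EFinP/measurable_funM => //; exact: measurable_normal_pdf.
- apply/measurable_EFinP/measurable_funM; last exact: measurable_normal_pdf.
  by have /measurable_int/measurable_EFinP := integrable_onem_tanh q.
- move=> z _; rewrite lee_fin.
  have := expRN_sqr_normal_pdf (Num.sqrt q) z; rewrite sqr_sqrtr//= => <-.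
  by rewrite ler_wpM2r ?normal_pdf_ge0// onem_tanh_ge.
Qed.

(** By [F_le] it is enough that 1 - q < e^(-q/2) / sqrt (1 + q). Indeed 1 - q < e^-q, which is
    e^(-q/2) squared, and sqrt (1 + q) <= e^(q/2) because 1 + q <= e^q. *)
Lemma F_lt_id (R : realType) (q : R) : 0 < q -> F q < q.
Proof.
move=> q0; apply: (le_lt_trans (F_le (ltW q0))).
rewrite ltrBlDr -ltrBlDl.
apply: (lt_le_trans (@expR_gt1Dx _ (- q) _)); first by rewrite oppr_eq0 gt_eqF.
have -> : - q = - (q / 2) - q / 2 by field.
rewrite expRD ler_wpM2l ?expR_ge0// expRN lef_pV2 ?posrE ?expR_gt0//.
- rewrite -[leRHS]ger0_norm ?expR_ge0// -sqrtr_sqr ler_wsqrtr//.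
  by rewrite -expRM_natr divfK ?pnatr_eq0// expR_ge1Dx.
- by rewrite sqrtr_gt0; lra.
Qed.

Lemma F0 (R : realType) : F (0 : R) = 0.
Proof.
apply/le_anti; rewrite F_ge0// andbT; apply: le_trans (@F_le R 0 _) _ => //.
by rewrite mul0r oppr0 expR0 addr0 sqrtr1 divr1 subrr.
Qed.

Lemma F_le_id (R : realType) (q : R) : 0 <= q -> F q <= q.
Proof.
rewrite le_eqVlt => /predU1P[<-|/F_lt_id/ltW//].
by rewrite F0.
Qed.

(** * Diagonal of the resolvent of a positive semidefinite matrix *)

Section resolvent.
Variables (R : realFieldType) (n : nat) (M : 'M[R]_n) (d : 'rV[R]_n).
Hypothesis M_sym : M^T = M.
Hypothesis M_psd : forall x : 'cV[R]_n, 0 <= (x^T *m M *m x) 0 0.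
Hypothesis d_ge0 : forall i, 0 <= d 0 i.
Let D := diag_mx d.
Let A := 1%:M + D *m M.

(** If u A = 0, then w = u D satisfies u = - w M. Pairing with w gives w M w^T + sum_i d_i u_i^2 =
    0, a sum of nonnegative terms, so each d_i u_i vanishes; thus w = 0 and u = 0. *)
Lemma unitmx_id_plus_diag_psd : A \in unitmx.
Proof.
rewrite -row_free_unit -kermx_eq0; apply/rowV0P => u /sub_kermxP.
rewrite mulmxDr mulmx1 mulmxA => /eqP; rewrite addr_eq0 => /eqP uE.
set w := u *m D in uE.
have wE i : w 0 i = d 0 i * u 0 i by rewrite /w mul_mx_diag mxE mulrC.
clearbody w.
have : (w *m M *m w^T) 0 0 + \sum_i d 0 i * u 0 i ^+ 2 = 0.
  have -> : w *m M = - u by rewrite [in RHS]uE opprK.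
  rewrite mxE -big_split/= big1// => i _.
  by rewrite !mxE wE; ring.
move=> /eqP; rewrite paddr_eq0; last 2 first.
- by have := M_psd w^T; rewrite trmxK.
- by apply: sumr_ge0 => i _; rewrite mulr_ge0// sqr_ge0.
rewrite psumr_eq0; last by move=> i _; rewrite mulr_ge0// sqr_ge0.
move=> /andP[_ /allP du].
suff w0 : w = 0 by rewrite uE w0 mul0mx oppr0.
apply/rowP => i; rewrite wE mxE; apply/eqP.
by have := du i (mem_index_enum i); rewrite mulf_eq0 expf_eq0/= -mulf_eq0.
Qed.

(* With V = M A^-1 and W = D V one has M = V + M W, and the (t, t) entry of
   M - V = M W is sum_s V_st W_st + sum_s (M W)_st W_st. *)
Lemma resolvent_diag_bounds t :
  0 <= (M - M *m invmx A) t t <= \sum_s M t s ^+ 2 * d 0 s.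
Proof.
pose V := M *m invmx A; pose W := D *m V; pose Z := M *m W.
have AV : invmx A + W = 1%:M.
  rewrite /W /V mulmxA -[X in X + _]mul1mx -mulmxDl mulmxV//.
  exact: unitmx_id_plus_diag_psd.
have ZE : M - M *m invmx A = Z.
  by rewrite /Z -[X in X - _]mulmx1 -AV mulmxDr addrC addKr.
have MVZ : M = V + Z by rewrite -ZE -/V [RHS]addrC subrK.
have ME s : M t s = V s t + Z s t by rewrite -{1}M_sym mxE {1}MVZ mxE.
have WE s : W s t = d 0 s * V s t by rewrite /W mul_diag_mx mxE.
(* This sum is the quadratic form of [M] at column [t] of [W]. *)
have Q0 : 0 <= \sum_s d 0 s * V s t * Z s t.
  have := M_psd (col t W); rewrite -mulmxA !colE (mulmxA M) -/Z -!colE mxE.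
  under eq_bigr => s _ do rewrite [_^T _ _]mxE [col t W _ _]mxE WE
    [col t Z _ _]mxE.
  exact.
have ZtE : Z t t = \sum_s d 0 s * V s t ^+ 2 + \sum_s d 0 s * V s t * Z s t.
  rewrite {1}/Z mxE -big_split/=; apply: eq_bigr => s _.
  by rewrite ME WE; ring.
rewrite ZE ZtE; apply/andP; split.
  by rewrite addr_ge0// sumr_ge0// => s _; rewrite mulr_ge0// sqr_ge0.
rewrite -[leLHS]addr0 -subr_ge0.
have -> : \sum_s M t s ^+ 2 * d 0 s -
    (\sum_s d 0 s * V s t ^+ 2 + \sum_s d 0 s * V s t * Z s t + 0) =
    \sum_s d 0 s * V s t * Z s t + \sum_s d 0 s * Z s t ^+ 2.
  rewrite addr0 -!big_split/= -sumrB; apply: eq_bigr => s _.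
  by rewrite ME; ring.
by rewrite addr_ge0// sumr_ge0// => s _; rewrite mulr_ge0// sqr_ge0.
Qed.

End resolvent.

(** * Sup norm and Lyapunov stability of the origin *)

(** The norm is a maximum that starts from 0, whence the condition [0 <= b]. *)
Lemma rV_norm_leP (R : realType) (n : nat) (x : 'rV[R]_n) (b : R) : 0 <= b ->
  reflect (forall i, `|x 0 i| <= b) (`|x| <= b).
Proof.
move=> b0; have -> : `|x| = \big[Num.max/0]_ij `|x ij.1 ij.2| := mx_normrE x.
apply: (iffP (bigmax_leP _ _ _ _)).
  by move=> [_ xb] i; exact: (xb (0, i)).
by move=> xb; split=> // -[i j] _ /=; rewrite ord1.
Qed.

(** The norm cannot grow along an orbit, which stays in the orthant, so delta = eps works. *)
Lemma lyapunov_stable0 (R : realType) (n : nat) (g : 'rV[R]_n -> 'rV[R]_n) :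
  (forall x, nonneg_orthant x -> nonneg_orthant (g x) /\ `|g x| <= `|x|) ->
  lyapunov_stable (@nonneg_orthant R n) g 0.
Proof.
move=> g_ok e e0; exists e => // x x0 xe k; move: xe; rewrite !subr0.
apply: le_lt_trans.
suff [] : nonneg_orthant (iter k g x) /\ `|iter k g x| <= `|x| by [].
elim: k => [//|k [IH0 IH]] /=.
by have [gk0 /le_trans gk] := g_ok _ IH0; split=> //; exact: gk.
Qed.

(** * The iteration for equal correlations and equal signal-to-noise ratios *)

Section equicorrelated.
Variables (R : realType) (n : nat) (c lam : R) (C : 'M[R]_n).
Variables (lambda alpha : 'I_n -> R).
Hypotheses (c_ge0 : 0 <= c) (c_le1 : c <= 1) (lam_gt0 : 0 < lam).
Hypothesis C_diag : forall t, C t t = 1.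
Hypothesis C_off : forall t t', t != t' -> C t t' = c.
Hypothesis lambdaE : forall t, lambda t = lam.
Hypothesis alphaE : forall t, alpha t = 1.

Let CE : C = (1 - c)%:M + const_mx c.
Proof.
apply/matrixP => t t'; rewrite !mxE; have [->|tt'] := eqVneq t t'.
  by rewrite C_diag subrK.
by rewrite C_off// add0r.
Qed.

Let MmxE : Mmx lambda C = lam *: C.
Proof.
apply/matrixP => t t'; rewrite !mxE /sigma !lambdaE.
by rewrite -invfM invrK -expr2 sqr_sqrtr ?(ltW lam_gt0)// mulrC.
Qed.

Let Mmx_sym : (Mmx lambda C)^T = Mmx lambda C.
Proof.
by rewrite MmxE CE linearZ/= linearD/= tr_scalar_mx trmx_const.
Qed.

(** The form equals lam ((1 - c) sum_i x_i^2 + c (sum_i x_i)^2), read off from the decomposition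
    [CE]. *)
Let Mmx_psd (x : 'cV[R]_n) : 0 <= (x^T *m Mmx lambda C *m x) 0 0.
Proof.
rewrite MmxE -scalemxAr -scalemxAl mxE mulr_ge0 ?(ltW lam_gt0)//.
rewrite CE mulmxDr mulmxDl mxE addr_ge0//.
  rewrite mul_mx_scalar -scalemxAl mxE mulr_ge0 ?subr_ge0//.
  by rewrite mxE sumr_ge0// => i _; rewrite mxE -expr2 sqr_ge0.
have -> : (x^T *m const_mx c *m x) 0 0 = c * (\sum_i x i 0) ^+ 2.
  rewrite mxE expr2 mulr_sumr mulr_sumr; apply: eq_bigr => i _.
  rewrite mxE mulrA; congr (_ * _); rewrite mulr_sumr; apply: eq_bigr => j _.
  by rewrite !mxE mulrC.
by rewrite mulr_ge0// sqr_ge0.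
Qed.

Lemma G_bounds (q : 'rV[R]_n) t : nonneg_orthant q ->
  0 <= G lambda alpha C q 0 t <= \sum_s (lam * C t s) ^+ 2 * F (q 0 s).
Proof.
move=> q0; rewrite /G /qu_of_qv mxE.
set d := \row__ _.
have dE s : d 0 s = F (q 0 s) by rewrite !mxE alphaE mul1r.
have -> : \sum_s (lam * C t s) ^+ 2 * F (q 0 s) =
    \sum_s Mmx lambda C t s ^+ 2 * d 0 s.
  by apply: eq_bigr => s _; rewrite dE MmxE [(lam *: C) t s]mxE.
apply: resolvent_diag_bounds => // s.
by rewrite dE F_ge0.
Qed.

Lemma sum_sqr_row t :
  \sum_s (lam * C t s) ^+ 2 = lam ^+ 2 * (1 + (n%:R - 1) * c ^+ 2).
Proof.
rewrite (bigD1 t)//= C_diag mulr1 [RHS]mulrDr mulr1; congr (_ + _).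
under eq_bigr => s st do rewrite C_off 1?eq_sym// exprMn.
rewrite sumr_const cardC1 card_ord -[LHS]mulr_natl -[n.-1]subn1.
rewrite natrB; first by ring.
(* The index [t] itself witnesses 1 <= n, so that n - 1 is a true subtraction. *)
exact: leq_ltn_trans (ltn_ord t).
Qed.

Hypothesis subcritical : lam ^+ 2 * (1 + (n%:R - 1) * c ^+ 2) <= 1.

Lemma G_nonexpansive (q : 'rV[R]_n) : nonneg_orthant q ->
  nonneg_orthant (G lambda alpha C q) /\ `|G lambda alpha C q| <= `|q|.
Proof.
move=> q0; split=> [t|]; first by have /andP[] := G_bounds t q0.
apply/rV_norm_leP => // t.
have /andP[G0 GF] := G_bounds t q0; rewrite ger0_norm//; apply: (le_trans GF).
rewrite -[leRHS]mul1r; apply: (@le_trans _ _ (\sum_s (lam * C t s) ^+ 2 * `|q|)).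
  apply: ler_sum => s _; rewrite ler_wpM2l ?sqr_ge0//.
  apply: (le_trans (F_le_id (q0 s))); rewrite -[leLHS]ger0_norm ?q0//.
  exact: (rV_norm_leP _ (normr_ge0 q)).
by rewrite -mulr_suml sum_sqr_row ler_wpM2r.
Qed.

Lemma G_fixed_point_eq0 (q : 'rV[R]_n) : nonneg_orthant q ->
  (forall t, q 0 t = G lambda alpha C q 0 t) -> q = 0.
Proof.
move=> q0 qG; apply/eqP; apply: contraT => qn0.
have [[i t] qt] : exists ij, `|q| = `|q ij.1 ij.2|.
  apply: (@mx_norm_neq0 _ _ _ q).
  by rewrite -[mx_norm q]/(`|q|) normr_eq0.
move: qt; rewrite /= ord1 => qt.
have q_gt0 : 0 < `|q| by rewrite normr_gt0.
have qs s : q 0 s <= `|q|.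
  rewrite -[leLHS]ger0_norm ?q0//; exact: (rV_norm_leP _ (normr_ge0 q)).
suff : `|q| < `|q| by rewrite ltxx.
rewrite {1}qt ger0_norm ?q0// qG.
have /andP[_ /le_lt_trans] := G_bounds t q0; apply.
rewrite -[ltRHS]mul1r.
apply: (@lt_le_trans _ _ (\sum_s (lam * C t s) ^+ 2 * `|q|)); last first.
  by rewrite -mulr_suml sum_sqr_row ler_wpM2r// ltW.
(* Strictness comes from the term s = t: its weight is lam^2 > 0 and q_t = |q| > 0, so [F_lt_id]
   applies. The other terms are compared weakly. *)
rewrite (bigD1 t)//= [ltRHS](bigD1 t)//= ltr_leD//.
  rewrite C_diag mulr1 ltr_pM2l ?exprn_gt0//.
  by rewrite qt ger0_norm// F_lt_id// -[ltRHS]ger0_norm// -qt.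
apply: ler_sum => s _; rewrite ler_wpM2l ?sqr_ge0//.
by apply: le_trans (qs s); exact: F_le_id.
Qed.

End equicorrelated.

Unset Implicit Arguments.
Set Strict Implicit.

(** * Impossibility up to the threshold *)

Theorem mainTheorem5 (R : realType) (T : nat) (hT : (1 <= T)%N)
  (alpha : 'I_T -> R) (halpha : forall t, alpha t = 1)
  (c : R) (hc0 : 0 < c) (hc1 : c < 1)
  (C : 'M[R]_T) (hCdiag : forall t, C t t = 1)
  (hCoff : forall t t', t != t' -> C t t' = c)
  (lam : R) (hlam0 : 0 < lam)
  (lambda : 'I_T -> R) (hlambda : forall t, lambda t = lam)
  (hlam : lam <= 1 / Num.sqrt (1 + (T%:R - 1) * c ^+ 2)) :
  (exists qu qv : 'rV[R]_T, overlaps lambda alpha C qu qv) /\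
  (forall qu qv : 'rV[R]_T, overlaps lambda alpha C qu qv ->
     forall t : 'I_T, impossible qu t).
Proof.
have K0 : 0 < 1 + (T%:R - 1) * c ^+ 2.
  by rewrite ltr_pwDl// mulr_ge0 ?sqr_ge0// subr_ge0 ler1n.
have sub : lam ^+ 2 * (1 + (T%:R - 1) * c ^+ 2) <= 1.
  move: hlam; rewrite ler_pdivlMr ?sqrtr_gt0// => lamK.
  rewrite -(sqr_sqrtr (ltW K0)) -exprMn expr_le1//.
  by rewrite mulr_ge0 ?sqrtr_ge0// ltW.
have [c0 c1] := (ltW hc0, ltW hc1).
have Gne := G_nonexpansive c0 c1 hlam0 hCdiag hCoff hlambda halpha sub.
have G0 := G_fixed_point_eq0 c0 c1 hlam0 hCdiag hCoff hlambda halpha sub.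
have qv0 : qv_of_qu (0 : 'rV[R]_T) = 0 by apply/rowP => t; rewrite !mxE F0.
split.
  exists 0, 0; split; last exact: lyapunov_stable0.
  have p0 : nonneg_orthant (0 : 'rV[R]_T) by move=> t; rewrite mxE.
  split=> // t; last by rewrite !mxE F0.
  (* Nonexpansiveness at 0 reads |G 0| <= 0, so 0 is a fixed point. *)
  have [_] := Gne 0 p0; rewrite normr0 normr_le0 /G qv0 => /eqP ->.
  by rewrite mxE.
move=> qu qv [[qu0 _ quE qvE] _] t.
(* Eliminating [qv] turns the two overlap equations into the fixed-point equation of [G]. *)
have qvE' : qv = qv_of_qu qu by apply/rowP => s; rewrite qvE mxE.
by rewrite /impossible (G0 qu) ?mxE// => s; rewrite quE qvE'.
Qed.
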